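(* Let $(\mu,\nu)$ be any valid pair. Almost surely the following hold. (1) $\chi_{S_n}\to\chi_S$ pointwise as $n\to\infty$; that is, for every $i\ge 0$, $\chi_{S_n}(b_i)\to\chi_S(b_i)$. (2) $|S|=\liminf_{n\to\infty}|S_n|$.
   Context: Bullet process. Let $\mu$ (velocity distribution) and $\nu$ (delay distribution) be probability measures on $(0,\infty)$, and let $(v_i,\Delta_i)_{i\ge 0}$ be i.i.d. with law $\mu\otimes\nu$. Bullet $b_i=(i,v_i,\Delta_i)$ has index $i$, velocity $v_i$ and delay $\Delta_i$. Given bullets $(b_i)_{i\in J}$ indexed by a finite or infinite set $J=\{m,m+1,\dots\}$ of consecutive nonnegative integers, the bullet process on them is defined as follows: $b_i$ is fired from the origin at time $t_i=\sum_{m<j\le i}\Delta_j$ (so the first bullet is fired at time $0$) and its trajectory is $d_t(i)=v_i(t-t_i)$ for $t\ge t_i$. It becomes active at time $t_i$ and remains active until the first time, if ever, it collides with (is at the same position as) another active bullet; colliding bullets annihilate and are inactive at all later times. A bullet perishes in the process if it is annihilated, and otherwise survives in it. The pair $(\mu,\nu)$ is valid if almost surely no three bullets collide simultaneously. This is assumed throughout. $S$ denotes the set of bullets that survive in the process on the full sequence $(b_0,b_1,\dots)$, and $S_n$ the set of bullets that survive in the process on $(b_0,\dots,b_n)$. For a set $A$ of bullets, $\chi_A$ is its characteristic function: $\chi_A(b_i)=1$ if $b_i\in A$ and $\chi_A(b_i)=0$ otherwise. Cardinalities take values in $\{0,1,2,\dots\}\cup\{\infty\}$. *)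

(* Defs.v *)
From HB Require Import structures.
From mathcomp Require Import all_boot all_order all_algebra finmap.
From mathcomp Require Import all_classical all_reals all_analysis.
From mathcomp Require Import lra.

Set Implicit Arguments.
Unset Strict Implicit.
Unset Printing Implicit Defensive.
Import Order.TTheory GRing.Theory Num.Theory.
Import numFieldNormedType.Exports.
Local Open Scope classical_set_scope.
Local Open Scope ring_scope.

Section BulletProcess.
Context {R : realType}.

(* A bullet is the pair (velocity, delay) and is identified with its index.
   In all of this section J is the index set of the process, a set of
   consecutive integers, and m is its least element: the delay of bullet m
   plays no role. *)
Implicit Types (b : nat -> R * R) (m : nat) (J : set nat).
Implicit Types (act : nat -> R -> Prop).

Definition velocity b (i : nat) : R := (b i).1.
Definition delay b (i : nat) : R := (b i).2.

Definition fire_time b m (i : nat) : R := \sum_(m.+1 <= j < i.+1) delay b j.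

Definition position b m (i : nat) (t : R) : R :=
  velocity b i * (t - fire_time b m i).

Definition collide b m act (i j : nat) (t : R) : Prop :=
  [/\ i <> j, act i t, act j t & position b m i t = position b m j t].

(* Bullets are still active at the very time of their collision, and inactive
   at all later times. *)
Definition bullet_rule b m J act : Prop :=
  forall i t, act i t <->
    [/\ J i, fire_time b m i <= t &
        ~ exists j s, s < t /\ collide b m act i j s].

(* The activity relation of the process is the relation that satisfies the
   rule: it exists and is unique whenever velocities and delays are positive
   and only finitely many bullets are fired in bounded time
   (bullet_rule_exists_unique below), hence for every finite J and, for i.i.d.
   positive delays, almost surely for every infinite J. The default value is
   only used outside of this case. *)
Definition active b m J : nat -> R -> Prop :=
  xget (fun _ _ => False) [set act | bullet_rule b m J act].

Definition perishes b m J (i : nat) : Prop :=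
  exists j t, collide b m (active b m J) i j t.

Definition survivors b m J : set nat := [set i | J i /\ ~ perishes b m J i].

Definition no_triple_collision b m J : Prop :=
  ~ exists i j k t, [/\ collide b m (active b m J) i j t,
                        collide b m (active b m J) j k t & i <> k].

End BulletProcess.

Section BulletRule.
Context {R : realType} (b : nat -> R * R) (m : nat) (J : set nat).
Context (Jm : forall i, J i -> (m <= i)%N).
Context (velocity_gt0 : forall i, 0 < velocity b i).
Context (delay_gt0 : forall i, 0 < delay b i).
Context (finitely_fired :
  forall T, exists K, forall i, J i -> fire_time b m i <= T -> (i < K)%N).

Let step (act : nat -> R -> Prop) : nat -> R -> Prop := fun i t =>
  [/\ J i, fire_time b m i <= t &
      ~ exists j s, s < t /\ collide b m act i j s].

Let fire_time_lt i j : J i -> (i < j)%N -> fire_time b m i < fire_time b m j.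
Proof.
move=> Ji ij; have mi := Jm Ji; rewrite /fire_time.
rewrite [ltRHS](big_cat_nat (n := i.+1)) //=; last exact: ltnW.
rewrite ltrDl big_nat_recr //=.
by apply: ltr_wpDl => //; rewrite sumr_ge0// => k _; exact: ltW.
Qed.

(* the only possible meeting time of two trajectories *)
Let meet (i j : nat) : R :=
  (velocity b i * fire_time b m i - velocity b j * fire_time b m j) /
  (velocity b i - velocity b j).

Let meetE i j s : J i -> J j -> i <> j ->
  position b m i s = position b m j s -> s = meet i j.
Proof.
move=> Ji Jj ij pE.
have fij : fire_time b m i != fire_time b m j.
  have [lt_ij|lt_ji|//] := ltngtP i j.
    by rewrite lt_eqF// fire_time_lt.
  by rewrite gt_eqF// fire_time_lt.
have [vE|vij] := eqVneq (velocity b i) (velocity b j).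
  move: pE; rewrite /position vE => /mulfI; rewrite gt_eqF//.
  by move=> /(_ isT) /addrI /oppr_inj /eqP; rewrite (negbTE fij).
apply: (canRL (mulfK _)); first by rewrite subr_eq0.
by move: pE; rewrite /position; lra.
Qed.

Let pairs K : seq (nat * nat) :=
  [seq (i, j) | i <- iota 0 K, j <- iota 0 K].

Let rank K (t : R) := count (fun p => meet p.1 p.2 < t) (pairs K).

Let rank_lt K T i j s t :
  (forall i, J i -> fire_time b m i <= T -> (i < K)%N) -> t <= T -> s < t ->
  J i -> J j -> fire_time b m i <= s -> fire_time b m j <= s -> i <> j ->
  position b m i s = position b m j s -> (rank K s < rank K t)%N.
Proof.
move=> KT tT st Ji Jj fi fj ij pE.
have sT : s <= T by apply: le_trans tT; exact: ltW.
have iK : (i < K)%N by apply: KT => //; exact: le_trans sT.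
have jK : (j < K)%N by apply: KT => //; exact: le_trans sT.
have sE := meetE Ji Jj ij pE.
have pin : (i, j) \in pairs K.
  by apply/allpairsP; exists (i, j); rewrite !mem_iota.
rewrite /rank; set A := fun p => _ < s; set B := fun p => _ < t.
have -> : count B (pairs K) =
    (count A (pairs K) + count (fun p => B p && ~~ A p) (pairs K))%N.
  rewrite -(count_predUI A) (@eq_count _ (predU _ _) B); last first.
    move=> p /=; rewrite /A /B; case: (ltP _ s) => [ps|_] /=; last by rewrite andbT.
    by rewrite (lt_trans ps st).
  rewrite (@eq_count _ (predI _ _) pred0) ?count_pred0 ?addn0// => p /=.
  by case: (A p); rewrite ?andbF.
rewrite -[ltnLHS]addn0 ltn_add2l -has_count; apply/hasP; exists (i, j) => //.
by rewrite /A /B /= -sE st ltxx.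
Qed.

(* two relations that agree at all collision times of lower rank have the same
   image under one step *)
Let step_local K T t a a' :
  (forall i, J i -> fire_time b m i <= T -> (i < K)%N) -> t <= T ->
  (forall i s, a i s -> J i /\ fire_time b m i <= s) ->
  (forall i s, s < t -> (rank K s < rank K t)%N -> a i s -> a' i s) ->
  forall i, step a' i t -> step a i t.
Proof.
move=> KT tT aJ aa' i [Ji fi H]; split=> // -[j [s [st [ij ai aj pE]]]].
have [_ fis] := aJ _ _ ai; have [Jj fjs] := aJ _ _ aj.
have rk := rank_lt KT tT st Ji Jj fis fjs ij pE.
by apply: H; exists j, s; split=> //; split=> //; apply: aa'.
Qed.

Let step_J a i s : step a i s -> J i /\ fire_time b m i <= s.
Proof. by case. Qed.

Lemma bullet_rule_exists_unique : exists act, bullet_rule b m J act /\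
  forall act', bullet_rule b m J act' -> act' = act.
Proof.
pose A n := iter n step (fun _ _ => False).
have AJ n i s : A n i s -> J i /\ fire_time b m i <= s.
  by case: n => // n; exact: step_J.
have stab K T : (forall i, J i -> fire_time b m i <= T -> (i < K)%N) ->
    forall r t, t <= T -> (rank K t < r)%N ->
    forall p q i, (r <= p)%N -> (r <= q)%N -> A p i t -> A q i t.
  move=> KT; elim=> // r IH t tT rt [|p] [|q] i //; rewrite !ltnS => rp rq.
  apply: (step_local KT tT (@AJ q)) => j s st rk; apply: IH => //.
    by apply: le_trans tT; exact: ltW.
  exact: leq_trans rk _.
pose act i t := exists n, forall p, (n <= p)%N -> A p i t.
have actJ i s : act i s -> J i /\ fire_time b m i <= s.
  by move=> [n /(_ n (leqnn n))]; exact: AJ.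
have actE K T : (forall i, J i -> fire_time b m i <= T -> (i < K)%N) ->
    forall t, t <= T -> forall p i, (rank K t < p)%N -> act i t <-> A p i t.
  move=> KT t tT p i rp; split=> [[n H]|Ap].
    apply: (stab _ _ KT (rank K t).+1 t tT _ (maxn n p)) => //.
      by rewrite (leq_trans rp)// leq_maxr.
    by apply: H; rewrite leq_maxl.
  exists p => q pq; apply: (stab _ _ KT (rank K t).+1 t tT _ p) => //.
  exact: leq_trans rp pq.
have actR : bullet_rule b m J act.
  move=> i t; have [K KT] := finitely_fired t.
  rewrite (actE _ _ KT t (lexx t) (rank K t).+1)//=.
  split; apply: (step_local KT (lexx t)) => //; do ?by [exact: actJ|exact: AJ].
  - by move=> j s st rk; rewrite (actE _ _ KT s (ltW st) (rank K t)).
  - by move=> j s st rk; rewrite (actE _ _ KT s (ltW st) (rank K t)).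
exists act; split=> // act' R'; apply/funext => i; apply/funext => t.
apply/propext; have [K KT] := finitely_fired t.
have act'J j s : act' j s -> J j /\ fire_time b m j <= s by move=> /R'[].
suff H r : forall u, u <= t -> (rank K u < r)%N -> forall j, act' j u <-> act j u.
  exact: (H (rank K t).+1).
elim: r => // r IH u ut rk j.
rewrite R' actR; split; apply: (step_local KT ut) => // k s su sk;
  by rewrite IH//; [exact: le_trans (ltW su) ut | exact: leq_trans sk _].
Qed.

Lemma active_rule : bullet_rule b m J (active b m J).
Proof.
have [act [actR _]] := bullet_rule_exists_unique.
exact: (@xgetI _ _ [set act | bullet_rule b m J act] _ actR).
Qed.

End BulletRule.

Section BulletLaw.
Context {R : realType}.
(* The sequence X of (velocity, delay) pairs is i.i.d. with law mu \x nu. *)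
Definition iid_bullets d (T : measurableType d) (P : probability T R)
    (X : nat -> {RV P >-> (measurableTypeR R * measurableTypeR R)%type})
    (mu nu : probability (measurableTypeR R) R) : Prop :=
  (forall i A, measurable A -> distribution P (X i) A = (mu \x nu)%E A) /\
  (forall (I : {fset nat})
      (A : nat -> set (measurableTypeR R * measurableTypeR R)),
    (forall i, measurable (A i)) ->
    P (\bigcap_(i in [set` I]) (X i @^-1` A i)) =
    (\prod_(i <- I) P (X i @^-1` A i))%E).

(* Almost surely no three bullets collide simultaneously in the process on the
   full sequence. This depends only on the pair (mu, nu): it is required of
   every i.i.d. realization. *)
Definition valid_pair (mu nu : probability (measurableTypeR R) R) : Prop :=
  forall d (T : measurableType d) (P : probability T R)
    (X : nat -> {RV P >-> (measurableTypeR R * measurableTypeR R)%type}),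
  iid_bullets X mu nu ->
  {ae P, forall w, no_triple_collision (fun i => X i w) 0 [set: nat]}.

End BulletLaw.

(* Main.v *)
Require Import Defs.
From HB Require Import structures.
From mathcomp Require Import all_boot all_order all_algebra finmap.
From mathcomp Require Import all_classical all_reals all_analysis.
From mathcomp Require Import measurable_realfun lra zify.

Import Order.TTheory GRing.Theory Num.Theory.
Import numFieldNormedType.Exports.
Local Open Scope classical_set_scope.
Local Open Scope ring_scope.

(** Almost surely all velocities and delays are positive and the firing times
    are unbounded ([regular], [ae_regular]). Then bullets that are active keep
    the order in which they were fired, because overtaking is colliding
    ([active_order]): as long as a bullet is active, those behind it and those
    before it do not interact. Most of the proof compares the process on a set
    of bullets with the process on a subset, through the principle that they
    agree until the first collision between the subset and the rest
    ([active_agree]).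

    Granted (1), statement (2) holds for every regular sequence. Fatou's
    inequality gives |S| <= liminf |S_n|. Conversely, given N, let n be the
    largest index among N and the bullets that collide with one of b_0..b_N in
    the full process. No collision of the full process joins a bullet of index
    at most n to one of larger index: it would involve one of b_0..b_N,
    against the choice of n, or cross the collision that involves n. So the
    process on b_0..b_n is a restriction of the full one and S_n is contained
    in S ([survivors_cut]); such n are arbitrarily large.

    For (1), the process on b_0..b_n and the full one agree until b_n is fired,
    so a bullet that perishes in the full process perishes in all large finite
    ones. The converse fails for some regular sequences: say that k hits i if
    they collide in the process on b_i..b_k ([hits]); b_i may survive although
    infinitely many k hit it, each of these being stopped from behind by later
    bullets. This is the only obstruction ([survivors_stabilize]), and it has
    probability zero, for the following reason.

    If infinitely many k hit i, then b_i survives in the process on b_i, ...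
    ([hits_io_survives]), and therefore every k that hits i is stopped by the
    bullets behind it ([hits_perishes]). Put a bullet of a fixed speed r in
    front of b_(k+1), b_(k+2), ...; the probability [escape r] that it survives
    depends neither on k nor on b_0..b_k, and a faster bullet survives
    whenever a slower one does ([survivors_faster]).
    - If [escape r = 0], then almost surely no b_i of speed at most r survives
      in the process on b_i, ..., so such a b_i is hit finitely often.
    - If [escape r > 0], let C_k be the event that k hits i and that b_i has
      speed at least r. A bullet that hits b_i is faster than b_i, so on
      E = limsup C_k the first k >= m such that C_k holds is stopped from
      behind; the independence of past and future gives
      P(E) <= (1 - escape r) P(union of the C_k, k >= m). Let m go to infinity:
      P(E) <= (1 - escape r) P(E), hence P(E) = 0 ([fast_hits_null]).
    Countably many r suffice for all speeds ([threshold_sequence]).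

    The activity relation is the solution of a fixed-point equation. For a
    regular sequence it is the limit of the iterates of that equation, tested
    at the meeting times of pairs of trajectories only ([activity_limE]); these
    iterates are measurable, and so are the events above. *)

(** * Collisions of a regular sequence *)

Section Deterministic.
Set Implicit Arguments.
Unset Strict Implicit.
Context {R : realType}.
Implicit Types (b : nat -> R * R) (J : set nat) (s t tau : R).

Definition regular b := [/\ forall i, 0 < velocity b i, forall i, 0 < delay b i &
  forall t, exists n, t < fire_time b 0 n].

(** The time at which the lines carrying two trajectories cross; for
    equal velocities it is a dummy value, harmless because [collide] tests the
    positions. *)
Definition meet b i j : R :=
  (velocity b i * fire_time b 0 i - velocity b j * fire_time b 0 j) *
  (velocity b i - velocity b j)^-1.

(** Collision times without reference to activity, so that one well-founded
    induction serves all processes on the same sequence. *)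
Definition crossing b s := exists i j,
  [/\ i <> j, fire_time b 0 i <= s, fire_time b 0 j <= s &
      position b 0 i s = position b 0 j s].

Lemma fire_timeS b i : fire_time b 0 i.+1 = fire_time b 0 i + delay b i.+1.
Proof. by rewrite /fire_time big_nat_recr. Qed.

Lemma fire_time_mono b : regular b -> {mono fire_time b 0 : i j / (i < j)%N >-> i < j}.
Proof.
move=> [_ d0 _]; apply/leW_mono/le_mono/(homo_ltn lt_trans) => i.
by rewrite fire_timeS ltrDl.
Qed.

Lemma fire_time_le b i j : regular b -> (i <= j)%N -> fire_time b 0 i <= fire_time b 0 j.
Proof.
move=> gb; rewrite leq_eqVlt => /orP[/eqP->//|ij].
by apply/ltW; rewrite fire_time_mono.
Qed.

Lemma fire_time_shift b k n :
  fire_time b 0 (k + n) = fire_time (fun j => b (k + j)%N) 0 n + fire_time b 0 k.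
Proof.
elim: n => [|n IH].
  by rewrite addn0 [fire_time (fun=> _) 0 0]big_geq// add0r.
by rewrite addnS !fire_timeS IH addrAC /delay addnS.
Qed.

Lemma fire_time_ext b b' n : (forall j, b' j.+1 = b j.+1) ->
  fire_time b' 0 n = fire_time b 0 n.
Proof.
by move=> bE; rewrite /fire_time; apply: eq_big_nat => -[//|j] _; rewrite /delay bE.
Qed.

Lemma regular_shift b k : regular b -> regular (fun j => b (k + j)%N).
Proof.
move=> gb; have [v0 d0 unb] := gb; split=> [i|i|t].
- exact: v0.
- exact: d0.
- have [n tn] := unb (t + fire_time b 0 k); exists n.
  rewrite -(ltrD2r (fire_time b 0 k)) -fire_time_shift (lt_le_trans tn)//.
  by rewrite fire_time_le// leq_addl.
Qed.

Lemma meetE b i j s : regular b -> i <> j ->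
  position b 0 i s = position b 0 j s -> s = meet b i j.
Proof.
move=> gb ij pE; have [v0 _ _] := gb.
have fij : fire_time b 0 i != fire_time b 0 j.
  have [lt_ij|lt_ji|//] := ltngtP i j.
    by rewrite lt_eqF// fire_time_mono.
  by rewrite gt_eqF// fire_time_mono.
have [vE|vij] := eqVneq (velocity b i) (velocity b j); last first.
  apply: (canRL (mulfK _)); first by rewrite subr_eq0.
  by move: pE; rewrite /position; lra.
move: pE; rewrite /position vE => /mulfI; rewrite gt_eqF// => /(_ isT).
by move=> /addrI /oppr_inj /eqP; rewrite (negbTE fij).
Qed.

Lemma fired_finite b T : regular b ->
  exists K, forall i, fire_time b 0 i <= T -> (i < K)%N.
Proof.
move=> gb; have [_ _ /(_ T)[K KT]] := gb; exists K => i iT.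
by rewrite -(fire_time_mono gb) (le_lt_trans iT).
Qed.

Lemma active_regular b J : regular b -> bullet_rule b 0 J (active b 0 J).
Proof.
move=> gb; have [v0 d0 _] := gb; apply: active_rule => // T.
by have [K KT] := fired_finite T gb; exists K => i _; exact: KT.
Qed.

(** Only finitely many pairs of trajectories meet before [T]: the rank of a
    time counts the meeting times that precede it. *)
Lemma crossing_rank b T : regular b -> exists rk : R -> nat,
  forall s t, t <= T -> s < t -> crossing b s -> (rk s < rk t)%N.
Proof.
move=> gb; have [K KT] := fired_finite T gb.
pose ms := undup [seq meet b i j | i <- iota 0 K, j <- iota 0 K].
exists (fun t => size [seq u <- ms | u < t]) => s t tT st [i [j [ij fi fj pE]]].
have sE := meetE gb ij pE.
have sT : s <= T by apply/ltW/(lt_le_trans st).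
have sms : s \in ms.
  rewrite mem_undup; apply/allpairsP; exists (i, j).
  by rewrite !mem_iota /= !add0n !KT ?(le_trans _ sT).
have/uniq_leq_size : uniq (s :: [seq u <- ms | u < s]).
  by rewrite /= mem_filter ltxx filter_uniq// undup_uniq.
apply=> u; rewrite inE => /orP[/eqP->|]; rewrite !mem_filter ?st//.
by move=> /andP[us ->]; rewrite (lt_trans us st).
Qed.

(** What is active at time [t] is decided by what is active at the earlier
    crossing times, and these are locally finite. *)
Lemma crossing_ind b (P : R -> Prop) : regular b ->
  (forall t, (forall s, s < t -> crossing b s -> P s) -> P t) -> forall t, P t.
Proof.
move=> gb H T; have [rk rkP] := crossing_rank T gb.
suff K n : forall t, t <= T -> (rk t < n)%N -> P t by exact: (K (rk T).+1).
elim: n => // n IH t tT tn; apply: H => s st cs.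
apply: IH; first exact: le_trans (ltW st) tT.
by rewrite -ltnS (leq_trans _ tn)// ltnS; exact: rkP st cs.
Qed.

Lemma active_in b J i t : regular b -> active b 0 J i t ->
  J i /\ fire_time b 0 i <= t.
Proof. by move=> gb /(active_regular J gb)[]. Qed.

Lemma active_le b J i s t : regular b -> active b 0 J i t ->
  fire_time b 0 i <= s -> s <= t -> active b 0 J i s.
Proof.
move=> gb /(active_regular J gb)[Ji _ H] fs st; apply/(active_regular J gb).
split=> // -[j [u [us c]]]; apply: H; exists j, u; split=> //.
exact: lt_le_trans us st.
Qed.

Lemma collide_sym b a i j t : collide b 0 a i j t -> collide b 0 a j i t.
Proof. by move=> [/nesym ij ai aj pE]; split. Qed.

Lemma collide_last b J i j s t : regular b -> collide b 0 (active b 0 J) i j s ->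
  active b 0 J i t -> t <= s.
Proof.
move=> gb c /(active_regular J gb)[_ _ H]; rewrite leNgt; apply/negP => st.
by apply: H; exists j, s.
Qed.

Lemma collide_time b J i j j' s s' : regular b ->
  collide b 0 (active b 0 J) i j s -> collide b 0 (active b 0 J) i j' s' ->
  s = s'.
Proof.
move=> gb c c'; have [[_ a _ _] [_ a' _ _]] := (c, c').
by apply/eqP; rewrite eq_le (collide_last gb c' a) (collide_last gb c a').
Qed.

Lemma collide_crossing b J i j s : regular b ->
  collide b 0 (active b 0 J) i j s -> crossing b s.
Proof.
move=> gb [ij /(active_in gb)[_ fi] /(active_in gb)[_ fj] pE].
by exists i, j.
Qed.

Lemma active_survives b J i : regular b -> J i ->
  ~ perishes b 0 J i -> forall t, fire_time b 0 i <= t -> active b 0 J i t.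
Proof.
move=> gb Ji np t ft; apply/(active_regular J gb); split=> // -[j [s [_ c]]].
by apply: np; exists j, s.
Qed.

(** Two processes can only start to differ on [J'] after a bullet of [J'] has
    collided with one outside. The absence of such a collision at time [s] may
    be proved from the agreement up to [s], which replaces any choice of a
    first time of interaction. *)
Lemma active_agree b J J' tau : regular b -> J' `<=` J ->
  (forall s, s < tau ->
     (forall i u, J' i -> u <= s -> active b 0 J' i u <-> active b 0 J i u) ->
     forall i k, J' i -> J k -> ~ J' k ->
     ~ collide b 0 (active b 0 J) i k s) ->
  forall i t, J' i -> t <= tau -> active b 0 J' i t <-> active b 0 J i t.
Proof.
move=> gb J'J H; suff K t : t <= tau ->
    forall i u, J' i -> u <= t -> active b 0 J' i u <-> active b 0 J i u.
  by move=> i t J'i ttau; exact: (K t).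
move: t; apply: (crossing_ind gb) => t IH ttau i u J'i ut.
rewrite (active_regular J' gb) (active_regular J gb).
split=> -[_ fu nc].
- split=> //; first exact: J'J.
  move=> [k [s [su c]]]; apply: nc; exists k, s; split=> //.
  have st : s < t by exact: lt_le_trans su ut.
  have ag := IH s st (collide_crossing gb c) (ltW (lt_le_trans st ttau)).
  have [ik ai ak pE] := c.
  have J'k : J' k.
    apply: contrapT => nJ'k; apply: (H s _ ag i k) => //.
      exact: lt_le_trans st ttau.
    by have [] := active_in gb ak.
  by split=> //; apply/ag.
- split=> // -[k [s [su c]]]; apply: nc; exists k, s; split=> //.
  have st : s < t by exact: lt_le_trans su ut.
  have ag := IH s st (collide_crossing gb c) (ltW (lt_le_trans st ttau)).
  have [ik ai ak pE] := c; have [J'k _] := active_in gb ak.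
  by split=> //; apply/ag.
Qed.

(** Bullet [j] starts behind [i]; to be ahead of it at time [t] it must have
    crossed it at an earlier time, when both were active, so that neither
    would be active at time [t]. *)
Lemma active_order b J i j t : regular b -> (i < j)%N ->
  active b 0 J i t -> active b 0 J j t -> position b 0 j t <= position b 0 i t.
Proof.
move=> gb ij ai aj; have [v0 _ _] := gb.
have fij : fire_time b 0 i < fire_time b 0 j by rewrite fire_time_mono.
have [_ fj] := active_in gb aj.
rewrite leNgt; apply/negP => lt_ij.
have vij : velocity b i < velocity b j.
  rewrite ltNge; apply/negP => vji.
  move: lt_ij; apply/negP; rewrite -leNgt /position.
  apply: ler_pM => //; [exact: ltW|by rewrite subr_ge0|].
  by rewrite lerB// ltW.
pose s := meet b i j.
have sE : s * (velocity b j - velocity b i) =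
    velocity b j * fire_time b 0 j - velocity b i * fire_time b 0 i.
  rewrite /s /meet -mulrA -[velocity b j - _]opprB mulrN mulVf ?subr_eq0 ?lt_eqF//.
  lra.
have vv : 0 < velocity b j - velocity b i by rewrite subr_gt0.
have fs : fire_time b 0 j <= s.
  rewrite -(ler_pM2r vv) sE.
  have := v0 i; move: fij; nra.
have st : s < t.
  by rewrite -(ltr_pM2r vv) sE; move: lt_ij; rewrite /position; lra.
suff c : collide b 0 (active b 0 J) i j s.
  by have := collide_last gb c ai; rewrite leNgt st.
split.
- by move=> ijE; rewrite ijE ltnn in ij.
- by apply: active_le (ltW st) => //; exact: le_trans (ltW fij) fs.
- exact: active_le (ltW st).
- by apply/eqP; rewrite -subr_eq0 /position; apply/eqP; move: sE; lra.
Qed.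

Lemma collide_between b J i j k s : regular b -> (i < j < k)%N ->
  collide b 0 (active b 0 J) i k s -> active b 0 J j s ->
  collide b 0 (active b 0 J) i j s /\ collide b 0 (active b 0 J) j k s.
Proof.
move=> gb /andP[ij jk] [_ ai ak pE] aj.
have p1 := active_order gb ij ai aj.
have p2 := active_order gb jk aj ak.
have pij : position b 0 i s = position b 0 j s by lra.
by split; split=> //; [lia|lia|rewrite -pij].
Qed.

Lemma collide_velocity b J i k s : regular b -> (i < k)%N ->
  collide b 0 (active b 0 J) i k s ->
  velocity b i < velocity b k /\ fire_time b 0 k < s.
Proof.
move=> gb ik [_ ai ak]; have [_ fk] := active_in gb ak.
have [v0 _ _] := gb.
have fik : fire_time b 0 i < fire_time b 0 k by rewrite fire_time_mono.
have := v0 i; have := v0 k; rewrite /position => vk vi pE.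
have fks : fire_time b 0 k < s.
  rewrite lt_neqAle fk andbT; apply/negP => /eqP ks.
  by move: pE; rewrite -ks subrr mulr0 => /eqP; rewrite mulf_eq0; lra.
split=> //; rewrite ltNge; apply/negP => vki; nra.
Qed.



(** * Comparison of processes on intervals of bullets *)

Definition from i := [set k | (i <= k)%N].
Definition between i k := [set j | (i <= j <= k)%N].

(** The rule of the process only sees velocities and differences of firing
    times. *)
Lemma active_shift b b' k c J : regular b -> regular b' ->
  (forall j, J j -> velocity b' j = velocity b (k + j)) ->
  (forall j, J j -> fire_time b 0 (k + j) = fire_time b' 0 j + c) ->
  forall j t, J j ->
  active b' 0 J j t <-> active b 0 [set addn k i | i in J] (k + j) (t + c).
Proof.
move=> gb gb' vE fE.
have pE j s : J j -> position b 0 (k + j) (s + c) = position b' 0 j s.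
  by move=> Jj; rewrite /position vE// fE//; congr (_ * _); lra.
move=> j t; move: t j; apply: (crossing_ind gb') => t IH j Jj.
rewrite (active_regular J gb') (active_regular _ gb) fE// lerD2r.
split=> -[_ fj nc]; split=> //; [|move=> [l [s [st c']]]| move=> [l [s [st c']]]].
- by exists j.
- have [jl aj al plE] := c'.
  have [[l' Jl' lE] _] := active_in gb al; subst l.
  have [_ fj'] := active_in gb aj; have [_ fl'] := active_in gb al.
  have sE : s = (s - c) + c by rewrite subrK.
  have st' : s - c < t by rewrite ltrBlDr.
  rewrite sE !pE// in plE; rewrite fE// in fj'; rewrite fE// in fl'.
  have jl' : j <> l' by move=> E; apply: jl; rewrite E.
  have cr : crossing b' (s - c) by exists j, l'; split=> //; rewrite lerBrDr.
  apply: nc; exists l', (s - c); split=> //; split=> //.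
  + by rewrite IH// subrK.
  + by rewrite IH// subrK.
- have [jl aj al plE] := c'; have [Jl _] := active_in gb' al.
  apply: nc; exists (k + l)%N, (s + c); rewrite ltrD2r; split=> //; split.
  + by move=> /addnI.
  + by rewrite -IH//; exact: collide_crossing gb' c'.
  + by rewrite -IH//; exact: collide_crossing gb' c'.
  + by rewrite !pE.
Qed.

Lemma survivors_tail b i : regular b -> survivors b 0 (from i) i ->
  forall j t, (i < j)%N -> active b 0 (from i.+1) j t <-> active b 0 (from i) j t.
Proof.
move=> gb [_ sv] j t ij.
apply: (active_agree gb (tau := t)) => //; first by move=> l; exact: ltnW.
move=> s st _ l k il ik ilk c; apply: sv.
have ki : k = i by move: ilk ik il; rewrite /from /=; lia.
by rewrite ki in c; exists l, s; exact: collide_sym c.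
Qed.

Lemma survivors_shift b k : regular b ->
  survivors b 0 (from k) k <-> survivors (fun j => b (k + j)%N) 0 setT 0%N.
Proof.
move=> gb; set b' := fun j => _.
have gb' : regular b' by exact: regular_shift.
have fE j : setT j -> fire_time b 0 (k + j) = fire_time b' 0 j + fire_time b 0 k.
  by move=> _; exact: fire_time_shift.
have imE : [set addn k i | i in setT] = from k.
  apply/seteqP; split=> [_ [j _ <-]|j kj]; first by rewrite /from /= leq_addr.
  by exists (j - k)%N => //; rewrite subnKC.
have aE := @active_shift b b' k (fire_time b 0 k) setT gb gb' (fun _ _ => erefl) fE.
rewrite imE in aE.
have pE l u : position b 0 (k + l) (u + fire_time b 0 k) = position b' 0 l u.
  by rewrite /position fE//; congr (_ * _); lra.
split=> -[_ sv]; (split; first by rewrite /from /=) => -[j [t [ij ai aj ijE]]]; apply: sv.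
- exists (k + j)%N, (t + fire_time b 0 k); split; first by lia.
  + by move/(aE _ _ I): ai; rewrite addn0; exact.
  + by move/(aE _ _ I): aj.
  + by rewrite -{1}[k]addn0 !pE.
- have [kj _] := active_in gb aj.
  have kE : j = (k + (j - k))%N by rewrite subnKC.
  exists (j - k)%N, (t - fire_time b 0 k); split.
  + by move: kj ij; rewrite /from /=; lia.
  + by apply/(aE _ _ I); rewrite addn0 subrK.
  + by apply/(aE _ _ I); rewrite subrK -kE.
  + by rewrite -!pE addn0 -kE subrK.
Qed.

(** Suppose that the faster leader is hit by [j] at time [s]. Without the leader
    [j] would also be active at time [s]; hence it is active then in the
    presence of the slower leader, which never interacts with anybody. But at
    that time [j] would be at least as far as the slower leader. *)
Lemma survivors_faster b b' : regular b -> regular b' ->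
  (forall j, b' j.+1 = b j.+1) -> velocity b 0 <= velocity b' 0 ->
  survivors b 0 setT 0%N -> survivors b' 0 setT 0%N.
Proof.
move=> gb gb' bE vv sv; split=> // -[j [s c]].
have fE l : fire_time b 0 l = fire_time b' 0 l.
  exact/esym/fire_time_ext.
have T0 : setT = from 0 by apply/seteqP; split.
have [j0 a0 aj pE] := c.
have fj := (active_in gb' aj).2.
have {}j0 : (0 < j)%N by lia.
have aj' : active b' 0 (from 1) j s.
  apply/(active_agree gb' (J := setT) (tau := s)) => //.
  move=> s' s's _ l k l1 _ k1 c'.
  have k0 : k = 0%N by move: k1; rewrite /from /=; lia.
  subst k; have := collide_time gb' c (collide_sym c').
  by move=> ss'; rewrite ss' ltxx in s's.
have imE : [set addn 0 i | i in from 1] = from 1.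
  by apply/seteqP; split=> [_ [l /= ? <-]//|l l1]; exists l.
have {}aj' : active b 0 (from 1) j s.
  have vE l : from 1 l -> velocity b' l = velocity b (0 + l).
    by case: l => // l _; rewrite /velocity bE.
  have fE' l : from 1 l -> fire_time b 0 (0 + l) = fire_time b' 0 l + 0.
    by rewrite fE addr0.
  by move/(active_shift gb gb' vE fE' s j0): aj'; rewrite imE addr0.
have {aj} aj : active b 0 setT j s.
  by rewrite T0; apply/(survivors_tail gb) => //; rewrite -T0.
have {}a0 : active b 0 setT 0%N s.
  apply: active_survives => //; first by case: sv.
  by rewrite fE (le_trans _ fj)// fire_time_le.
have p0 := active_order gb j0 a0 aj.
case: sv => _; apply; exists j, s; split=> //; first by lia.
apply/eqP; rewrite eq_le p0 andbT.
have -> : position b 0 j s = position b' 0 j s.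
  by rewrite /position fE; case: (j) j0 => // l _; rewrite /velocity bE.
rewrite -pE /position fE ler_wpM2r// subr_ge0.
by rewrite (le_trans _ fj)// fire_time_le.
Qed.

(** The event that [k] hits [i] depends on the bullets up to [k] only; bullets
    behind [k] may prevent this collision in larger processes. *)
Definition hits b i k :=
  (i < k)%N /\ exists t, collide b 0 (active b 0 (between i k)) i k t.

Lemma active_fired b J n i t : regular b -> (i <= n)%N -> J i -> t <= fire_time b 0 n ->
  active b 0 [set j | J j /\ (j <= n)%N] i t <-> active b 0 J i t.
Proof.
move=> gb i_n Ji tn; apply: (active_agree gb (tau := fire_time b 0 n)) => //.
  by move=> j [].
move=> s sn _ j k [Jj jn] Jk nk [_ _ ak _]; apply: nk; split=> //.
have [_ fk] := active_in gb ak.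
by rewrite ltnW// -(fire_time_mono gb) (le_lt_trans fk).
Qed.

Lemma between_fromE i k : between i k = [set j | from i j /\ (j <= k)%N].
Proof. by apply/seteqP; split=> j; rewrite /between /from /= => /andP. Qed.

Lemma collide_mono b J J' i j t : (forall l, l = i \/ l = j ->
    active b 0 J l t <-> active b 0 J' l t) ->
  collide b 0 (active b 0 J) i j t -> collide b 0 (active b 0 J') i j t.
Proof.
by move=> e [ij ai aj pE]; split=> //; apply/e => //; [left|right].
Qed.

Lemma collide_next b J i j k s : regular b -> (i <= j)%N -> (j < k)%N ->
  collide b 0 (active b 0 J) i k s -> active b 0 J j s ->
  collide b 0 (active b 0 J) j k s.
Proof.
move=> gb; rewrite leq_eqVlt => /orP[/eqP-> //|ij] jk c aj.
by have [|] := collide_between gb _ c aj; rewrite ?ij.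
Qed.

(** By the order of active bullets, a collision across [j] takes place at the
    position of [j] and involves it; then [j] is inactive at later times. *)
Lemma collide_shielded b J i j k s t : regular b -> (i <= j)%N -> (j <= k)%N ->
  collide b 0 (active b 0 J) i k s -> active b 0 J j t -> s < t -> False.
Proof.
move=> gb ij; rewrite leq_eqVlt => /orP[/eqP jk|jk] c aj st.
  subst k; have := collide_last gb (collide_sym c) aj.
  by rewrite leNgt st.
have [_ _ ak _] := c; have [_ fk] := active_in gb ak.
have ajs : active b 0 J j s.
  apply: active_le aj _ (ltW st) => //.
  exact: le_trans (fire_time_le gb (ltnW jk)) fk.
by have := collide_last gb (collide_next gb ij jk c ajs) aj; rewrite leNgt st.
Qed.

(** The collision of [i] and [k] can only be prevented from behind, and the
    first bullet to do so must run into [k]. Until then the bullets behind [k]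
    ignore those before it, so they would also hit [k] in their own process. *)
Lemma hits_perishes b i k : regular b -> hits b i k ->
  survivors b 0 (from k) k -> ~ survivors b 0 (from i) i.
Proof.
move=> gb [ik [t c]] [_ sk] [_ si].
have bs : between i k `<=` from i by move=> j /andP[].
suff ag l' : between i k l' ->
    active b 0 (between i k) l' t <-> active b 0 (from i) l' t.
  apply: si; exists k, t; apply: collide_mono c => l'.
  by move=> [|] ->; apply: ag; rewrite /between /= leqnn ltnW.
move=> bl; apply: (active_agree gb bs (tau := t)) => // s st ags l1 l2 bl1 il2 nbl cs.
have [_ _ akt _] := c; have [_ _ a2 _] := cs; have [_ f2] := active_in gb a2.
have kl2 : (k < l2)%N.
  by move: nbl il2; rewrite /between /from /=; lia.
have /andP[il1 l1k] := bl1.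
have ak : active b 0 (from i) k s.
  apply/ags => //; first by rewrite /between /= leqnn ltnW.
  by apply: active_le akt _ (ltW st) => //; exact: le_trans (fire_time_le gb (ltnW kl2)) f2.
have ck := collide_next gb l1k kl2 cs ak.
apply: sk; exists l2, s; apply: collide_mono ck => l kl.
apply: iff_sym; apply: (active_agree gb (tau := s)) => //.
- by move=> l0 /= kl0; exact: leq_trans (ltnW ik) kl0.
- move=> s' s's _ l1' l2' kl1 _ kl2' c'.
  apply: collide_shielded (collide_sym c') ak s's => //.
  by move: kl2'; rewrite /from /=; lia.
- by case: kl => ->; rewrite /from //=; exact: ltnW.
Qed.

(** If [i] perished at time [s], it would perish at that time in the process on
    [i..k] for every [k] fired after [s]; but a bullet hits [i] only after it
    has been fired. *)
Lemma hits_io_survives b i : regular b -> (forall M, exists2 k, (M <= k)%N & hits b i k) ->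
  survivors b 0 (from i) i.
Proof.
move=> gb io; split; first by rewrite /from /=.
move=> [j [s c]]; have [_ _ /(_ s)[n sn]] := gb.
have [k nk [ik [t c']]] := io n.
have [_ fk] := collide_velocity gb ik c'.
have [_ ai _ _] := c'.
have snk : s < fire_time b 0 k by exact: lt_le_trans sn (fire_time_le gb nk).
have : active b 0 (between i k) i (fire_time b 0 k).
  by apply: active_le ai _ (ltW fk) => //; exact: fire_time_le (ltnW ik).
rewrite between_fromE (active_fired gb (ltnW ik))//; last by rewrite /from /=.
by move/(collide_last gb c); rewrite leNgt snk.
Qed.

(** Until they collide, [i] and [j] isolate the bullets between them. *)
Lemma hits_prefix b n i j t : regular b -> (i < j)%N ->
  collide b 0 (active b 0 [set l | (l <= n)%N]) i j t -> hits b i j.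
Proof.
move=> gb ij c; split=> //; exists t.
have [_ ai aj _] := c; have [jn _] := active_in gb aj.
suff ag l' : between i j l' ->
    active b 0 (between i j) l' t <-> active b 0 [set l | (l <= n)%N] l' t.
  apply: collide_mono c => l' lij; rewrite ag//.
  by case: lij => ->; rewrite /between /= leqnn ltnW.
move=> bl; apply: (active_agree gb (tau := t)) => //.
  by move=> l0 /andP[_ l0j]; rewrite /= (leq_trans l0j).
move=> s st _ l1 l2 /andP[il1 l1j] l2n nl2 cs.
have [l2i|il2] := ltnP l2 i.
  exact: collide_shielded (ltnW l2i) il1 (collide_sym cs) ai st.
have jl2 : (j < l2)%N by move: nl2; rewrite /between /= il2 /= ltnNge => /negP.
exact: collide_shielded l1j (ltnW jl2) cs aj st.
Qed.



(** * Truncated processes *)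

Lemma active_truncated b n i t : regular b -> (i <= n)%N -> t <= fire_time b 0 n ->
  active b 0 [set j | (j <= n)%N] i t <-> active b 0 setT i t.
Proof.
move=> gb i_n tn; rewrite -(active_fired gb i_n I tn).
by rewrite (_ : [set j | (j <= n)%N] = [set j | setT j /\ (j <= n)%N])//;
  apply/seteqP; split=> j // -[].
Qed.

Lemma fire_time_ge b (f : nat -> R) N : regular b ->
  exists2 n, (N <= n)%N & forall j, (j < N)%N -> f j <= fire_time b 0 n.
Proof.
move=> gb; have [_ _ /(_ (\sum_(j < N) `|f j|))[n fn]] := gb.
exists (maxn N n) => [|j jN]; first exact: leq_maxl.
apply: le_trans (fire_time_le gb (leq_maxr N n)); apply: le_trans (ltW fn).
rewrite (bigD1 (Ordinal jN))//= (le_trans (ler_norm _))// lerDl.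
by apply: sumr_ge0 => k _.
Qed.

(** Assume that [i] survives in the full process and perishes in the process on
    [0..n]. Its partner either precedes [i] or hits it, so only finitely many
    partners are possible; if [n] is fired after the corresponding meeting
    times, the collision already occurs in the full process. *)
Lemma survivors_stabilize b : regular b ->
  (forall i, exists N, forall k, hits b i k -> (k < N)%N) ->
  forall i, exists N, forall n, (N <= n)%N ->
    survivors b 0 [set j | (j <= n)%N] i <-> survivors b 0 setT i.
Proof.
move=> gb hfin i; have [N hN] := hfin i.
have [si|nsi] := pselect (survivors b 0 setT i).
  have [M NM Mf] := fire_time_ge (meet b i) (maxn i.+1 N) gb.
  exists M => n Mn; split=> // _.
  have i_n : (i <= n)%N by lia.
  split=> // -[j [t c]]; case: si => _; apply.
  have [ij ai aj pE] := c; have [jn _] := active_in gb aj.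
  have jN : (j < maxn i.+1 N)%N.
    by case: (ltnP i j) => [ij'|]; [have := hN _ (hits_prefix gb ij' c)|]; lia.
  have tn : t <= fire_time b 0 n.
    by rewrite (meetE gb ij pE) (le_trans (Mf _ jN))// fire_time_le.
  exists j, t; apply: collide_mono c => l lij.
  by apply: active_truncated => //; case: lij => ->.
have : perishes b 0 setT i by apply: contrapT => np; apply: nsi.
move=> [j [t c]]; have [_ _ /(_ t)[M tM]] := gb.
exists (maxn M (maxn i j)) => n Mn; split=> // -[_ si]; case: si.
exists j, t; apply: collide_mono c => l lij; apply: iff_sym.
apply: active_truncated => //; first by case: lij => ->; lia.
by rewrite (le_trans (ltW tM))// fire_time_le//; lia.
Qed.

(** Two crossing collisions are the same one: the earlier of the two would
    involve the inner bullet of the later one. *)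
Lemma collide_uncrossed b J i j k l s t : regular b ->
  (i < j)%N -> (j <= k)%N -> (k < l)%N ->
  collide b 0 (active b 0 J) i k s -> collide b 0 (active b 0 J) j l t ->
  collide b 0 (active b 0 J) i l s.
Proof.
move=> gb ij jk kl cik cjl.
have [ts|st|st] := ltgtP t s.
- have [_ _ ak _] := cik.
  by case: (collide_shielded gb jk (ltnW kl) cjl ak ts).
- have [_ aj _ _] := cjl.
  by case: (collide_shielded gb (ltnW ij) jk cik aj st).
subst t; have [_ ai ak pik] := cik; have [jl aj al pjl] := cjl.
have ckl := collide_next gb jk kl cjl ak.
have [_ _ _ pkl] := ckl.
by split=> //; [lia|rewrite pik].
Qed.

(** The truncation index is the largest partner of a bullet up to [N]. *)
Lemma survivors_cut b N : regular b ->
  exists2 n, (N <= n)%N &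
    survivors b 0 [set j | (j <= n)%N] `<=` survivors b 0 setT.
Proof.
move=> gb; pose P n := `[< n = N \/ exists i t, (i <= N)%N /\
  collide b 0 (active b 0 setT) i n t >].
(* the set of candidates is bounded: they are all fired before some time T *)
have [T [NT PT]] : exists T, fire_time b 0 N <= T /\
    forall i k t, (i <= N)%N -> collide b 0 (active b 0 setT) i k t -> t <= T.
  have ex i : exists u, forall k t, collide b 0 (active b 0 setT) i k t -> t <= u.
    have [[k [t c]]|no] := pselect (exists k t, collide b 0 (active b 0 setT) i k t).
      by exists t => k' t' c'; rewrite (collide_time gb c' c).
    by exists 0 => k t c; case: no; exists k, t.
  pose u i := projT1 (cid (ex i)).
  have [n Nn un] := fire_time_ge u N.+1 gb.
  exists (fire_time b 0 n); split; first by rewrite fire_time_le// ltnW.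
  by move=> i k t iN c; apply: le_trans (un _ iN); apply: (projT2 (cid (ex i))) c.
have [K KT] := fired_finite T gb.
have PK n : P n -> (n <= K)%N.
  move=> /asboolP[->|[i [t [iN c]]]]; first exact/ltnW/KT.
  have [_ _ an _] := c; have [_ fn] := active_in gb an.
  by apply/ltnW/KT/(le_trans fn)/(PT _ _ _ iN c).
have exP : exists n, P n by exists N; apply/asboolP; left.
have [n /asboolP Pn nmax] := ex_maxnP exP PK.
have Nn : (N <= n)%N by apply: nmax; apply/asboolP; left.
exists n => // i [i_n si]; split=> // -[k [t c]]; apply: si.
(* otherwise l would be a larger partner of a bullet up to N *)
have cut j l u : (j <= n)%N -> (n < l)%N ->
    ~ collide b 0 (active b 0 setT) j l u.
  move=> jn nl c'.
  have Nj : (N < j)%N.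
    rewrite ltnNge; apply/negP => jN; suff : (l <= n)%N by lia.
    by apply: nmax; apply/asboolP; right; exists j, u.
  case: Pn => [nN|[h [s [hN c'']]]]; first by lia.
  have := collide_uncrossed gb (leq_ltn_trans hN Nj) jn nl c'' c'.
  move=> chl; suff : (l <= n)%N by lia.
  by apply: nmax; apply/asboolP; right; exists h, s.
have kn : (k <= n)%N by rewrite leqNgt; apply/negP => nk; exact: cut c.
exists k, t; apply: collide_mono c => l lik; apply: iff_sym.
apply: (active_agree gb (tau := t)) => //; last by case: lik => ->.
by move=> s st _ j h /= jn _ /negP; rewrite -ltnNge => nh; exact: cut.
Qed.

End Deterministic.

(** * Cardinalities *)

Section CountingLiminf.
Set Implicit Arguments.
Unset Strict Implicit.
Context {R : realType}.
Local Open Scope ereal_scope.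

(** The first hypothesis gives Fatou's inequality, the second one the reverse. *)
Lemma counting_liminf (S : set nat) (Sn : nat -> set nat) :
  (forall i, S i -> exists N, forall n, (N <= n)%N -> Sn n i) ->
  (forall N, exists2 n, (N <= n)%N & Sn n `<=` S) ->
  counting (R := R) S = limn_einf (fun n => counting (R := R) (Sn n)).
Proof.
move=> SSn cut; rewrite limn_einf_lim.
have cnt (A B : set nat) : A `<=` B -> counting (R := R) A <= counting (R := R) B.
  by move=> AB; apply: le_measure => //; rewrite inE.
set u := fun n => _.
have ucvg : cvgn (einfs u) by exact: is_cvg_einfs.
apply/eqP; rewrite eq_le; apply/andP; split; last first.
  apply: lime_le => //; apply: nearW => n.
  have [m nm mS] := cut n.
  apply: (@le_trans _ _ (u m)); last exact: cnt.
  by apply: ereal_inf_lbound; exists m.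
have Kle K : counting (R := R) (S `&` `I_K) <= limn (einfs u).
  apply: lime_ge => //.
  have [N SN] : exists N, forall n, (N <= n)%N -> S `&` `I_K `<=` Sn n.
    elim: K => [|K [N HN]]; first by exists 0%N => n _ i [].
    have [/SSn[M HM]|nSK] := pselect (S K).
      exists (maxn N M) => n Mn i [Si]; rewrite /= ltnS leq_eqVlt.
      case/predU1P => [->|iK]; first by apply: HM; lia.
      by apply: (HN n); [lia|split].
    exists N => n Nn i [Si]; rewrite /= ltnS leq_eqVlt.
    by case/predU1P => [iK|iK]; [case: nSK; rewrite -iK|apply: HN].
  exists N => // n /= Nn; apply: le_ereal_inf_tmp => _ [m /= nm <-].
  by apply: cnt; apply: SN; exact: leq_trans nm.
have SE : \bigcup_K (S `&` `I_K) = S.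
  apply/seteqP; split=> [i [K _ []//]|i Si].
  by exists i.+1 => //; split=> //=.
have : counting (R := R) (S `&` `I_K) @[K --> \oo] --> counting (R := R) S.
  rewrite -{2}SE; apply: nondecreasing_cvg_mu => //.
  by move=> m n mn; apply/subsetPset => i [Si im]; split=> //=; exact: leq_trans mn.
move=> /[dup] h /cvg_lim <-//; apply: lime_le; first by apply/cvg_ex; eexists; exact: h.
by apply: nearW => K; exact: Kle.
Qed.

End CountingLiminf.

(** * Measurability of the activity relation *)

Section Iteration.
Set Implicit Arguments.
Unset Strict Implicit.
Context {R : realType}.
Implicit Types (b : nat -> R * R) (J : set nat) (s t tau : R).

(** Iterates of the rule from the empty relation. The quantification over
    times is restricted to meeting times, hence countable. *)
Fixpoint activity b J n : nat -> R -> Prop :=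
  if n is n'.+1 then fun i t => [/\ J i, fire_time b 0 i <= t &
    ~ exists j, meet b i j < t /\ collide b 0 (activity b J n') i j (meet b i j)]
  else fun _ _ => False.

Definition activity_lim b J i t :=
  exists n, forall p, (n <= p)%N -> activity b J p i t.

Lemma activity_in b J n i t : activity b J n i t -> J i /\ fire_time b 0 i <= t.
Proof. by case: n => // n []. Qed.

(** At a time of rank [r] all iterates of order larger than [r] are correct. *)
Lemma activity_limE b J : regular b -> activity_lim b J = active b 0 J.
Proof.
move=> gb; suff E T : exists n, forall p, (n <= p)%N ->
    forall i, activity b J p i T <-> active b 0 J i T.
  apply/funext => i; apply/funext => t; apply/propext.
  have [n En] := E t; split=> [[m Em]|ai].
    by apply/(En (maxn n m)); [exact: leq_maxl|exact/Em/leq_maxr].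
  by exists n => p np; apply/En.
have [rk rkP] := crossing_rank T gb; exists (rk T).+1 => p.
suff K t : t <= T -> (rk t < p)%N ->
  forall i, activity b J p i t <-> active b 0 J i t by exact: K.
elim: p t => // p IH t tT; rewrite ltnS => tp i.
have IHs s j k : s < t -> crossing b s ->
    collide b 0 (activity b J p) j k s <-> collide b 0 (active b 0 J) j k s.
  move=> st cs; have E := IH s (ltW (lt_le_trans st tT)) (leq_trans (rkP _ _ tT st cs) tp).
  by split; (case=> jk aj ak pE; split=> //; exact/E).
rewrite (active_regular J gb) /=; split=> -[Ji fi nc]; split=> //.
  move=> [j [s [st c]]]; apply: nc; exists j.
  have [ij _ _ pE] := c; rewrite -(meetE gb ij pE); split=> //.
  by apply/IHs => //; exact: collide_crossing c.
move=> [j [st c]]; apply: nc; exists j, (meet b i j); split=> //.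
apply/IHs => //; have [ij ai aj pE] := c; exists i, j; split=> //.
  exact: (activity_in ai).2.
exact: (activity_in aj).2.
Qed.

(** Versions of [hits] and of survival that define measurable events for all
    sequences, regular or not. *)
Definition hits_lim b i k := (i < k)%N /\
  collide b 0 (activity_lim b (between i k)) i k (meet b i k).

Lemma hits_limE b i k : regular b -> hits_lim b i k <-> hits b i k.
Proof.
move=> gb; rewrite /hits_lim activity_limE//; split=> -[ik].
  by move=> c; split=> //; eexists; exact: c.
move=> [t c]; split=> //.
by have [ij _ _ pE] := c; rewrite -(meetE gb ij pE).
Qed.

Definition survives_lim b i := ~ exists j,
  collide b 0 (activity_lim b setT) i j (meet b i j).

Lemma survives_limE b i : regular b -> survives_lim b i <-> survivors b 0 setT i.
Proof.
move=> gb; rewrite /survives_lim activity_limE//; split.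
  move=> si; split=> // -[j [t c]]; apply: si; exists j.
  by have [ij _ _ pE] := c; rewrite -(meetE gb ij pE).
by move=> [_ si] [j c]; apply: si; exists j, (meet b i j).
Qed.

End Iteration.

Section Measurability.
Set Implicit Arguments.
Unset Strict Implicit.
Context {R : realType} d (T : measurableType d).
Local Notation M := (measurableTypeR R).
Implicit Types (b : T -> nat -> M * M) (J : set nat) (f g : T -> M).

Lemma measurable_inv : measurable_fun setT (fun x : M => x^-1).
Proof.
(* also true at 0, where both sides vanish *)
rewrite (_ : (fun x : M => _) = (fun x : M => x * expR (- ln (x * x)))).
  apply: measurable_funM => //; apply: measurableT_comp => //.
  apply: measurable_funN; apply: measurableT_comp; first exact: measurable_ln.
  exact: measurable_funM.
apply/funext => x /=; have [->|x0] := eqVneq x 0; first by rewrite invr0 mul0r.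
rewrite expRN lnK ?posrE; last by rewrite -expr2 exprn_even_gt0.
by rewrite invfM mulrA divff// mul1r.
Qed.

Lemma measurable_setP (f : T -> bool) : measurable_fun setT f ->
  measurable [set w | f w].
Proof.
move=> mf; rewrite -[X in measurable X]setTI.
by rewrite (_ : [set w | f w] = f @^-1` [set true])//; exact: mf.
Qed.

(** Events of a process on bullets up to [n] must be measurable for the
    sigma-algebra of these bullets, hence the bounded index. *)
Definition mfun_upto b n := forall j, (j <= n)%N -> measurable_fun setT (b^~ j).

Lemma mfun_uptoS b n j : mfun_upto b n -> (j <= n)%N -> mfun_upto b j.
Proof. by move=> mb jn l lj; apply: mb; exact: leq_trans jn. Qed.

Lemma measurable_velocity b n : mfun_upto b n ->
  measurable_fun setT (fun w => velocity (b w) n : M).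
Proof. by move=> mb; apply: measurableT_comp => //; exact: mb. Qed.

Lemma measurable_fire_time b n : mfun_upto b n ->
  measurable_fun setT (fun w => fire_time (b w) 0 n : M).
Proof.
elim: n => [|n IH] mb.
  by under eq_fun do rewrite /fire_time big_geq//; exact: measurable_cst.
under eq_fun do rewrite fire_timeS.
apply: measurable_funD; first by apply: IH; exact: mfun_uptoS mb _.
by apply: measurableT_comp => //; exact: mb.
Qed.

Lemma measurable_position b n f : mfun_upto b n -> measurable_fun setT f ->
  measurable_fun setT (fun w => position (b w) 0 n (f w) : M).
Proof.
move=> mb mf; apply: measurable_funM; first exact: measurable_velocity.
by apply: measurable_funB => //; exact: measurable_fire_time.
Qed.

Lemma measurable_meet b i j : mfun_upto b i -> mfun_upto b j ->
  measurable_fun setT (fun w => meet (b w) i j : M).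
Proof.
move=> mi mj; apply: measurable_funM.
  apply: measurable_funB; apply: measurable_funM;
    by [exact: measurable_velocity|exact: measurable_fire_time].
apply: (measurableT_comp measurable_inv).
by apply: measurable_funB; exact: measurable_velocity.
Qed.

Lemma measurable_collide b (a : T -> nat -> R -> Prop) i j f :
  mfun_upto b i -> mfun_upto b j -> measurable_fun setT f ->
  measurable [set w | a w i (f w)] -> measurable [set w | a w j (f w)] ->
  measurable [set w | collide (b w) 0 (a w) i j (f w)].
Proof.
move=> mi mj mf ai aj.
have [ij|ij] := eqVneq i j.
  rewrite (_ : mkset _ = set0)//; apply/seteqP; split=> w // [].
  by rewrite ij.
rewrite (_ : mkset _ = [set w | a w i (f w)] `&` [set w | a w j (f w)] `&`
    [set w | position (b w) 0 i (f w) == position (b w) 0 j (f w)]).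
  apply: measurableI; first exact: measurableI.
  apply: measurable_setP.
  by apply: measurable_fun_eqr; exact: measurable_position.
apply/seteqP; split=> w /=; first by move=> [_ ? ? /eqP].
by move=> [[? ?] /eqP]; split=> //; exact/eqP.
Qed.

Lemma measurable_activity b J n i f : (forall j, J j -> mfun_upto b j) ->
  measurable_fun setT f -> measurable [set w | activity (b w) J n i (f w)].
Proof.
move=> mb; elim: n i f => [|n IH] i f mf /=; first exact: measurable0.
have [Ji|nJi] := pselect (J i); last first.
  by rewrite (_ : mkset _ = set0)//; apply/seteqP; split=> w // [].
rewrite (_ : mkset _ = [set w | fire_time (b w) 0 i <= f w] `&` ~` \bigcup_(j in J)
   ([set w | meet (b w) i j < f w] `&`
    [set w | collide (b w) 0 (activity (b w) J n) i j (meet (b w) i j)])); last first.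
  apply/seteqP; split=> w /=.
    move=> [_ fi nc]; split=> // -[j Jj [mf' c]]; apply: nc; by exists j.
  move=> [fi nc]; split=> // -[j [mf' c]]; apply: nc; exists j => //.
  by have [_ _ /activity_in[]] := c.
apply: measurableI.
  apply: measurable_setP; apply: measurable_fun_ler => //.
  exact/measurable_fire_time/mb.
apply: measurableC; apply: bigcup_measurable => j Jj.
have mm : measurable_fun setT (fun w => meet (b w) i j : M).
  by apply: measurable_meet; exact: mb.
apply: measurableI.
  by apply: measurable_setP; exact: measurable_fun_ltr.
by apply: measurable_collide => //; [exact: mb|exact: mb|exact: IH|exact: IH].
Qed.

Lemma measurable_activity_lim b J i f : (forall j, J j -> mfun_upto b j) ->
  measurable_fun setT f -> measurable [set w | activity_lim (b w) J i (f w)].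
Proof.
move=> mb mf.
rewrite (_ : mkset _ = \bigcup_n \bigcap_(p in [set p | (n <= p)%N])
   [set w | activity (b w) J p i (f w)]).
  apply: bigcupT_measurable => n; apply: bigcap_measurableType => p _.
  exact: measurable_activity.
by apply/seteqP; split=> w [n]; [exists n|exists n].
Qed.

Lemma measurable_hits_lim b i k : mfun_upto b k ->
  measurable [set w | hits_lim (b w) i k].
Proof.
move=> mb; have [ik|ki] := ltnP i k; last first.
  rewrite (_ : mkset _ = set0)//; apply/seteqP; split=> w // [].
  by rewrite ltnNge ki.
rewrite (_ : mkset _ = [set w | collide (b w) 0
    (activity_lim (b w) (between i k)) i k (meet (b w) i k)]); last first.
  by apply/seteqP; split=> w //= [].
have mbj j : between i k j -> mfun_upto b j by move=> /andP[_]; exact: mfun_uptoS.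
have [mi mk] : mfun_upto b i /\ mfun_upto b k by split=> //; exact: mfun_uptoS mb (ltnW ik).
by apply: measurable_collide => //; try exact: measurable_activity_lim;
  [exact: measurable_meet|exact: measurable_activity_lim (measurable_meet _ _)..].
Qed.

Lemma measurable_survives_lim b i : (forall n, mfun_upto b n) ->
  measurable [set w | survives_lim (b w) i].
Proof.
move=> mb; rewrite (_ : mkset _ = ~` \bigcup_j [set w |
    collide (b w) 0 (activity_lim (b w) setT) i j (meet (b w) i j)]); last first.
  apply/seteqP; split=> w /= nc; first by move=> [j _ c]; apply: nc; exists j.
  by move=> [j c]; apply: nc; exists j.
apply: measurableC; apply: bigcupT_measurable => j.
have mm := measurable_meet (mb i) (mb j).
by apply: measurable_collide => //; exact: measurable_activity_lim.
Qed.

End Measurability.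

(** * Independence of past and future *)

Section PiSystem.
Set Implicit Arguments.
Unset Strict Implicit.
Context {R : realType} d (T : measurableType d) (P : probability T R).
Local Open Scope ereal_scope.

(** Dynkin's lemma; [f] and [g] differ so that independence and equality in law
    are extended at once. *)
Lemma indep_pi_system U (H : set (set U)) (f g : T -> U) (B : set T) :
  measurable B -> setI_closed H ->
  (forall C, <<s H>> C -> measurable (f @^-1` C)) ->
  (forall C, <<s H>> C -> measurable (g @^-1` C)) ->
  (forall C, H C -> P (B `&` f @^-1` C) = P B * P (g @^-1` C)) ->
  forall C, <<s H>> C -> P (B `&` f @^-1` C) = P B * P (g @^-1` C).
Proof.
move=> mB HI mf mg HE.
pose E := [set C | <<s H>> C /\ P (B `&` f @^-1` C) = P B * P (g @^-1` C)].
suff sE : <<s H>> `<=` E by move=> C /sE[].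
have [sH0 sHD sHU] := smallest_sigma_algebra setT H.
have sHC C : <<s H>> C -> <<s H>> (~` C).
  by move=> HC; rewrite -setTD; exact: sHD.
have sHT : <<s H>> setT by have := sHC _ sH0; rewrite setC0.
rewrite -(setI_closed_g_dynkin_g_sigma_algebra HI).
apply: smallest_sub; last first.
  by move=> C HC; split; [exact: sub_sigma_algebra|exact: HE].
split.
- by split=> //; rewrite !preimage_setT setIT probability_setT mule1.
- move=> C [HC CE]; split; first exact: sHC.
  have Pfin : P B \is a fin_num by exact: fin_num_measure.
  rewrite -(preimage_setC f) -(preimage_setC g) -setDE.
  have Poo : P B < +oo by rewrite ltey_eq Pfin.
  have -> : P (B `\` f @^-1` C) = P B - P (B `&` f @^-1` C).
    by apply: measureD => //; exact: mf.
  rewrite CE.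
  rewrite (probability_setC P (mg _ HC)).
  rewrite muleBr ?mule1//.
- move=> F tF HF; have HF1 n : <<s H>> (F n) by have [] := HF n.
  split; first exact: sHU.
  rewrite !preimage_bigcup setI_bigcupr measure_bigcup//=; last 2 first.
  + by move=> n _; apply: measurableI => //; exact: mf.
  + apply/trivIsetP => i j _ _ ij; rewrite setIACA -preimage_setI.
    by move/trivIsetP : tF => /(_ _ _ I I ij) ->; rewrite preimage_set0 setI0.
  rewrite measure_bigcup//=; last 2 first.
  + by move=> n _; exact: mg.
  + apply/trivIsetP => i j _ _ ij; rewrite -preimage_setI.
    by move/trivIsetP : tF => /(_ _ _ I I ij) ->; rewrite preimage_set0.
  have Pfin : P B \is a fin_num by exact: fin_num_measure.
  rewrite -(fineK Pfin) -nneseriesZl//.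
  by apply: eq_eseriesr => n _; rewrite fineK//; have [] := HF n.
Qed.

End PiSystem.

Section Cylinders.
Set Implicit Arguments.
Unset Strict Implicit.
Context d (U : measurableType d).
Implicit Types (A B : nat -> set U) (n m : nat).

Definition box n A : set (nat -> U) := [set x | forall i, (i < n)%N -> A i (x i)].

Definition boxes n : set (set (nat -> U)) :=
  [set box n A | A in [set A | forall i, measurable (A i)]].

Definition cylinders : set (set (nat -> U)) := \bigcup_n boxes n.

Lemma boxI n A B : box n A `&` box n B = box n (fun i => A i `&` B i).
Proof.
apply/seteqP; split=> x; first by move=> [Ax Bx] i ni; split; [exact: Ax|exact: Bx].
by move=> AB; split=> i ni; have [] := AB i ni.
Qed.

Lemma boxes_setI n : setI_closed (boxes n).
Proof.
move=> _ _ [A mA <-] [B mB <-]; rewrite boxI; exists (fun i => A i `&` B i) => //.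
by move=> i; exact: measurableI.
Qed.

Lemma box_widen n m A : (n <= m)%N ->
  box n A = box m (fun i => if (i < n)%N then A i else setT).
Proof.
move=> nm; apply/seteqP; split=> x Ax i.
  by case: ifP => // ni _; exact: Ax.
by move=> ni; have := Ax i (leq_trans ni nm); rewrite ni.
Qed.

Lemma boxes_widen n m : (n <= m)%N -> boxes n `<=` boxes m.
Proof.
move=> nm _ [A mA <-]; rewrite (box_widen _ nm).
exists (fun i => if (i < n)%N then A i else setT) => // i.
by case: ifP.
Qed.

Lemma cylinders_setI : setI_closed cylinders.
Proof.
move=> B C [n _ Bn] [m _ Cm]; exists (maxn n m) => //.
apply: boxes_setI.
  exact: boxes_widen (leq_maxl n m) _ Bn.
exact: boxes_widen (leq_maxr n m) _ Cm.
Qed.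

Lemma boxes_coordinate n j (V : set U) : (j < n)%N -> measurable V ->
  boxes n [set x | V (x j)].
Proof.
move=> jn mV; exists (fun i => if i == j then V else setT).
  by move=> i; case: ifP.
apply/seteqP; split=> x /=; first by move=> /(_ j jn); rewrite eqxx.
by move=> Vx i _; case: eqP => // ->.
Qed.

End Cylinders.

Section IidBullets.
Set Implicit Arguments.
Unset Strict Implicit.
Context {R : realType} (mu nu : probability (measurableTypeR R) R)
  d (T : measurableType d) (P : probability T R)
  (X : nat -> {RV P >-> (measurableTypeR R * measurableTypeR R)%type})
  (X_iid : iid_bullets X mu nu).
Local Notation M := (measurableTypeR R).
Local Notation U := (M * M)%type.
Implicit Types (A : nat -> set U) (k n : nat).
Local Open Scope ereal_scope.

Definition bullets_from k (w : T) : nat -> U := fun j => X (k + j)%N w.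

Lemma measurable_bullets_from k (C : set (nat -> U)) : <<s @cylinders _ U>> C ->
  measurable (bullets_from k @^-1` C).
Proof.
suff sub : <<s @cylinders _ U>> `<=` [set C | measurable (bullets_from k @^-1` C)].
  exact: sub.
apply: smallest_sub.
  split.
  - by rewrite /= preimage_set0.
  - by move=> D mD; rewrite /= setTD -preimage_setC; exact: measurableC.
  - by move=> F mF; rewrite /= preimage_bigcup; exact: bigcupT_measurable.
move=> _ [n _ [A mA <-]] /=.
rewrite (_ : _ @^-1` _ = \bigcap_(i in [set i | (i < n)%N]) (X (k + i)%N @^-1` A i)).
  apply: bigcap_measurableType => i _.
  exact: measurable_funPTI.
by apply/seteqP; split.
Qed.

(** A pi-system that generates the sigma-algebra of the first [k] bullets. *)
Definition past_events k : set (set T) :=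
  [set bullets_from 0 @^-1` B | B in @boxes _ U k].

Lemma past_events_setI k : setI_closed (past_events k).
Proof.
move=> _ _ [B mB <-] [C mC <-]; exists (B `&` C); first exact: boxes_setI.
by rewrite preimage_setI.
Qed.

Lemma past_events_measurable k (C : set T) : <<s past_events k>> C -> measurable C.
Proof.
apply: smallest_sub; first exact: sigma_algebra_measurable.
move=> _ [B mB <-]; apply: measurable_bullets_from.
by apply: sub_sigma_algebra; exists k.
Qed.

Lemma prob_box n A : (forall i, measurable (A i)) ->
  P (bullets_from 0 @^-1` box n A) = \prod_(i <- iota 0 n) (mu \x nu) (A i).
Proof.
move=> mA; have [XA Xind] := X_iid.
have -> : bullets_from 0 @^-1` box n A =
    \bigcap_(i in [set` [fset x in iota 0 n]%fset]) (X i @^-1` A i).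
  apply/seteqP; split=> w Aw i /=.
    by rewrite inE /= mem_iota add0n => /Aw.
  by move=> ni; apply: (Aw i); rewrite /= inE /= mem_iota add0n.
rewrite Xind//; under eq_bigr do rewrite -[P _]/(distribution P (X _) _) XA//.
apply: perm_big; apply: uniq_perm; [exact: fset_uniq|exact: iota_uniq|].
by move=> i; rewrite inE.
Qed.

(** Independence and stationarity in one statement. Two uses of Dynkin's lemma,
    for the future and then for the past, reduce it to the product rule for
    boxes. *)
Lemma independent_future k (B : set T) (C : set (nat -> U)) :
  <<s past_events k>> B -> <<s @cylinders _ U>> C ->
  P (B `&` bullets_from k @^-1` C) = P B * P (bullets_from 0 @^-1` C).
Proof.
move=> sB sC; have mC := measurable_bullets_from k sC.
suff step D : past_events k D -> P (D `&` bullets_from k @^-1` C) =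
    P D * P (bullets_from 0 @^-1` C).
  have PC : P (bullets_from k @^-1` C) = P (bullets_from 0 @^-1` C).
    have : past_events k setT.
      exists setT; last by rewrite preimage_setT.
      by exists (fun=> setT) => //; apply/seteqP; split.
    by move/step; rewrite setTI probability_setT mul1e.
  rewrite setIC [RHS]muleC -PC.
  apply: (indep_pi_system (f := id) (g := id) mC (@past_events_setI k)) sB => //.
  - exact: past_events_measurable.
  - exact: past_events_measurable.
  - by move=> D sD; rewrite setIC step// muleC PC.
move=> {B sB mC} [_ [A mA <-] <-].
apply: (indep_pi_system _ (@cylinders_setI _ _)) sC; try exact: measurable_bullets_from.
  apply: measurable_bullets_from; apply: sub_sigma_algebra.
  by exists k => //; exists A.
move=> _ [n _ [A' mA' <-]].
pose AA i := if (i < k)%N then A i else A' (i - k)%N.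
have -> : bullets_from 0 @^-1` box k A `&` bullets_from k @^-1` box n A' =
    bullets_from 0 @^-1` box (k + n) AA.
  apply/seteqP; split=> w /=.
    move=> [Aw A'w] i ikn; rewrite /AA; case: ltnP => ik; first exact: Aw.
    have := A'w (i - k)%N; rewrite /bullets_from subnKC//; apply.
    by rewrite ltn_subLR.
  move=> Aw; split=> i ik.
    by have := Aw i; rewrite /AA ik; apply; rewrite ltn_addr.
  have := Aw (k + i)%N; rewrite ltn_add2l /AA [(_ < k)%N]ltnNge leq_addr addKn.
  exact.
rewrite !prob_box//; last by move=> i; rewrite /AA; case: ifP.
rewrite iotaD big_cat /= add0n; congr (_ * _).
  apply: eq_big_seq => i; rewrite mem_iota => /andP[_]; rewrite add0n => ik.
  by rewrite /AA ik.
rewrite -[k in iota k]addn0 iotaDl big_map; apply: eq_bigr => i _.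
by rewrite /AA ltnNge leq_addr /= addKn.
Qed.

End IidBullets.

(** * Regular sequences and leading bullets *)

Section Regularity.
Set Implicit Arguments.
Unset Strict Implicit.
Context {R : realType}.
Implicit Types (b x : nat -> R * R).

(** The delay 1 stands for any positive number: a process starts when its first
    bullet is fired. *)
Definition leader (r : R) x : nat -> R * R := fun n => if n is m.+1 then x m else (r, 1).

Lemma regular_leader b r k : regular b -> 0 < r -> regular (leader r (fun j => b (k.+1 + j)%N)).
Proof.
move=> gb r0; have [v0 d0 unb] := regular_shift k gb.
split=> [[|i]|[|i]|t]; rewrite ?/velocity ?/delay //=.
- by case: gb => + _ _; apply.
- by case: gb => _ + _; apply.
have [n tn] := unb t; exists n; rewrite (fire_time_ext (b := fun j => b (k + j)%N))//.
by move=> j /=; rewrite addnS.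
Qed.

Lemma fire_time_unbounded b (e : R) : 0 < e -> (forall i, 0 < delay b i) ->
  (forall k, exists j, e < delay b (k + j)%N) ->
  forall t, exists n, t < fire_time b 0 n.
Proof.
move=> e0 d0 de.
have inc n m : (n <= m)%N -> fire_time b 0 n <= fire_time b 0 m.
  move=> /subnKC<-; elim: (m - n)%N => [|k IH]; rewrite ?addn0// addnS fire_timeS.
  by rewrite (le_trans IH)// lerDl ltW.
have K m : exists n, m%:R * e <= fire_time b 0 n.
  elim: m => [|m [n IH]]; first by exists 0%N; rewrite mul0r /fire_time big_geq.
  have [j ej] := de n.+1; exists (n.+1 + j)%N.
  rewrite addSn fire_timeS mulrSr mulrDl mul1r lerD//; last exact: ltW.
  by rewrite (le_trans IH)// inc// leq_addr.
move=> t; have [n tn] := K (Num.truncn (t / e)).+1.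
exists n; apply: lt_le_trans tn; rewrite -ltr_pdivrMr//.
exact: truncnS_gt.
Qed.

(** Rational thresholds suffice for all speeds [v] but one: an exceptional [v]
    satisfies [~ Z q] for the rationals [q] above [v] and [Z q] for those below,
    and between two exceptional speeds there would be a contradictory
    rational. The exceptional speed, if there is one, is added to the
    thresholds. *)
Lemma threshold_sequence (Z : R -> Prop) : exists thr : nat -> R,
  forall v, 0 < v -> exists n, 0 < thr n /\
    ((v <= thr n /\ Z (thr n)) \/ (thr n <= v /\ ~ Z (thr n))).
Proof.
pose exc (v : R) := 0 < v /\ forall q : rat, 0 < ratr q :> R ->
  (v <= ratr q -> ~ Z (ratr q)) /\ (ratr q <= v -> Z (ratr q)).
have exc_uniq v v' : exc v -> exc v' -> v < v' -> False.
  move=> [v0 ev] [_ ev'] vv'; have [q] := rat_in_itvoo vv'.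
  rewrite in_itv /= => /andP[vq qv'].
  have q0 := lt_trans v0 vq.
  by apply: (ev q q0).1; [exact: ltW|apply: (ev' q q0).2; exact: ltW].
exists (fun n => if n is m.+1 then if choice.unpickle m is Some q then ratr q else 1
  else xget 1 exc) => v v0.
have [ev|nev] := pselect (exc v).
  exists 0%N; case: xgetP => [c _ ec|/(_ v)//].
  have -> : v = c.
    by case: (ltgtP v c) => // [vc|cv]; exfalso; [exact: exc_uniq vc|exact: exc_uniq cv].
  split; first by case: ec.
  by have [Zc|nZc] := pselect (Z c); [left|right].
apply: contrapT => no; apply: nev; split=> // q q0.
have {}no : ~ ((v <= ratr q /\ Z (ratr q)) \/ (ratr q <= v /\ ~ Z (ratr q))).
  by move=> h; apply: no; exists (choice.pickle q).+1; rewrite choice.pickleK.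
split; first by move=> vq Zq; apply: no; left.
by move=> qv; apply: contrapT => nZq; apply: no; right.
Qed.

Lemma faster_leader b k r : regular b -> 0 < r -> r <= velocity b k ->
  survivors (leader r (fun j => b (k.+1 + j)%N)) 0 setT 0%N ->
  survivors b 0 (from k) k.
Proof.
move=> gb r0 rv sp; apply/(survivors_shift k gb).
apply: survivors_faster sp => //; [exact: regular_leader|exact: regular_shift|..].
  by move=> j /=; rewrite addnS.
by rewrite /velocity addn0.
Qed.

Lemma slower_leader b k r : regular b -> 0 < r -> velocity b k <= r ->
  survivors b 0 (from k) k ->
  survivors (leader r (fun j => b (k.+1 + j)%N)) 0 setT 0%N.
Proof.
move=> gb r0 rv /(survivors_shift k gb) sp.
apply: survivors_faster sp => //; [exact: regular_shift|exact: regular_leader|..].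
  by move=> j /=; rewrite addnS.
by rewrite /velocity addn0.
Qed.

End Regularity.

(** * Almost sure properties of the bullets *)

Section AlmostSure.
Set Implicit Arguments.
Unset Strict Implicit.
Context {R : realType} (mu nu : probability (measurableTypeR R) R)
  (mu_pos : mu `]0, +oo[%classic = 1%E) (nu_pos : nu `]0, +oo[%classic = 1%E)
  d (T : measurableType d) (P : probability T R)
  (X : nat -> {RV P >-> (measurableTypeR R * measurableTypeR R)%type})
  (X_iid : iid_bullets X mu nu).
Local Notation M := (measurableTypeR R).
Local Notation U := (M * M)%type.
Local Open Scope ereal_scope.

Local Notation X_from k := (bullets_from X k).

Lemma measurable_coordinate j :
  measurable_fun [set: g_sigma_algebraType (@cylinders _ U)] (fun x => x j : U).
Proof.
move=> _ V mV; rewrite setTI; apply: sub_sigma_algebra; exists j.+1 => //.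
exact: boxes_coordinate.
Qed.

Lemma measurable_past k j : (j < k)%N ->
  measurable_fun [set: g_sigma_algebraType (past_events X k)] (fun w => X j w : U).
Proof.
move=> jk _ V mV; rewrite setTI; apply: sub_sigma_algebra.
by exists [set x | V (x j)] => //; exact: boxes_coordinate.
Qed.

Lemma prob_pair i (A B : set M) : measurable A -> measurable B ->
  P (X i @^-1` (A `*` B)) = mu A * nu B.
Proof.
move=> mA mB; have [XA _] := X_iid.
rewrite -[LHS]/(distribution P (X i) (A `*` B)) XA; last exact: measurableX.
by rewrite product_measure1E.
Qed.

Lemma ae_positive : {ae P, forall w, forall i,
  (0 < velocity (X_from 0 w) i)%R /\ (0 < delay (X_from 0 w) i)%R}.
Proof.
apply: ae_foralln => i.
pose A := X i @^-1` (`]0%R, +oo[%classic `*` `]0%R, +oo[%classic).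
have mA : measurable A by apply: measurable_funPTI; apply: measurableX.
exists (~` A); split; first exact: measurableC.
- apply: (etrans (probability_setC P mA)).
  by rewrite /A prob_pair// mu_pos nu_pos mule1 subee.
apply: subsetC => w [/=]; rewrite !in_itv /= !andbT => v0 d0.
by split.
Qed.

Definition short_delays (e : R) : set (nat -> U) := [set x | forall j, (delay x j <= e)%R].

Lemma measurable_short_delays e : <<s @cylinders _ U>> (short_delays e).
Proof.
rewrite (_ : short_delays e = \bigcap_j [set x | (delay x j <= e)%R]); last first.
  by apply/seteqP; split=> x xe j; [move=> _; exact: xe|exact: xe j I].
apply: (@bigcapT_measurable _ (g_sigma_algebraType (@cylinders _ U))) => j.
apply: measurable_setP; apply: measurable_fun_ler => //.
apply: measurableT_comp; first exact: measurable_snd.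
exact: measurable_coordinate.
Qed.

(** Let [p] be the probability that a delay is at most [e], with [e] so small
    that [p < 1], and [a] the probability that all delays are. Stationarity and
    independence give [a = p * a]. *)
Lemma short_delays_null : exists2 e : R, (0 < e)%R &
  forall k, P (X_from k @^-1` short_delays e) = 0.
Proof.
have [n nn] : exists n, nu [set` `]-oo, (n.+1%:R^-1%R : M)]] < 1.
  apply: contrapT => /forallNP no.
  have n0 n : nu [set` `](n.+1%:R^-1%R : M), +oo[] = 0.
    have -> : nu [set` `](n.+1%:R^-1%R : M), +oo[] = 1 - nu [set` `]-oo, (n.+1%:R^-1%R : M)]].
      by rewrite -setCitvl; exact: probability_setC.
    have -> : nu [set` `]-oo, (n.+1%:R^-1%R : M)]] = 1.
      apply/eqP; rewrite eq_le probability_le1//= leNgt; exact/negP.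
    by rewrite subee.
  have : nu (\bigcup_n [set` `](n.+1%:R^-1%R : M), +oo[]) = 0.
    apply/eqP; rewrite -measure_le0.
    rewrite (le_trans (measure_sigma_subadditive _ _ _ (@subset_refl _ _)))//.
      exact: bigcupT_measurable.
    by rewrite eseries0// => k _ _; exact: n0.
  rewrite (_ : \bigcup_n _ = `]0%R, +oo[%classic) ?nu_pos; first by move/eqP; rewrite onee_eq0.
  apply/seteqP; split=> [x [k _]|x] /=; rewrite !in_itv /= !andbT.
    by apply: lt_trans; rewrite invr_gt0.
  move=> x0; exists (Num.truncn x^-1) => //=; rewrite in_itv /= andbT.
  by rewrite invf_plt ?posrE// truncnS_gt.
exists (n.+1%:R^-1%R : R); first by rewrite invr_gt0.
set e := n.+1%:R^-1%R in nn *.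
have sC := measurable_short_delays e.
pose B := X 0%N @^-1` (setT `*` [set` `]-oo, e]]).
have sB : <<s past_events X 1>> B.
  rewrite -[B]setTI; apply: measurable_past => //.
  by apply: measurableX.
have a0 : P (X_from 0 @^-1` short_delays e) = 0.
  have E : X_from 0 @^-1` short_delays e = B `&` X_from 1 @^-1` short_delays e.
    apply/seteqP; split=> w /=.
      move=> we; split; last by move=> j; exact: we j.+1.
      by split=> //=; rewrite in_itv /=; exact: we 0%N.
    move=> [[_ /=]]; rewrite in_itv /= => e0 we [|j] //.
    exact: we j.
  have := independent_future X_iid sB sC.
  rewrite -E /B prob_pair// probability_setT mul1e.
  have : P (X_from 0 @^-1` short_delays e) \is a fin_num.
    by apply: fin_num_measure; exact: measurable_bullets_from.
  have : 0 <= P (X_from 0 @^-1` short_delays e) by [].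
  have : nu [set` `]-oo, e]] \is a fin_num by exact: fin_num_measure.
  move: nn; case: (nu _) => // p; case: (P _) => // a; rewrite lte_fin lee_fin.
  move=> p1 _ a0 _ [] ap; congr (_%:E); nra.
move=> k; have := independent_future (k := k) X_iid (B := setT) _ sC.
rewrite setTI probability_setT mul1e a0; apply.
apply: (@measurableT _ (g_sigma_algebraType (past_events X k))).
Qed.

Lemma ae_regular : {ae P, forall w, regular (X_from 0 w)}.
Proof.
have [e e0 Pe] := short_delays_null.
have long : {ae P, forall w, forall k, ~ short_delays e (X_from k w)}.
  apply: ae_foralln => k; exists (X_from k @^-1` short_delays e); split.
  - exact: measurable_bullets_from (measurable_short_delays e).
  - exact: Pe.
  - by move=> w /= /contrapT.
apply: filterS2 ae_positive long => w pos lg; split=> [i|i|].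
- by have [] := pos i.
- by have [] := pos i.
apply: fire_time_unbounded e0 _ _ => [i|k]; first by have [] := pos i.
apply: contrapT => /forallNP no; apply: (lg k) => j.
by rewrite leNgt; apply/negP; exact: no j.
Qed.

Definition leader_survives (r : R) : set (nat -> U) := [set x | survives_lim (leader r x) 0%N].

Lemma measurable_leader_survives r : <<s @cylinders _ U>> (leader_survives r).
Proof.
apply: (@measurable_survives_lim _ _ (g_sigma_algebraType (@cylinders _ U))) => n j _.
by case: j => [|j]; [exact: measurable_cst|exact: measurable_coordinate].
Qed.

Definition escape (r : R) := P (X_from 0 @^-1` leader_survives r).

Lemma prob_leader k r : P (X_from k @^-1` leader_survives r) = escape r.
Proof.
have := independent_future (k := k) X_iid (B := setT) _ (@measurable_leader_survives r).
rewrite setTI probability_setT mul1e; apply.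
apply: (@measurableT _ (g_sigma_algebraType (past_events X k))).
Qed.

(** As bullets that hit [i] are faster than [i], they all have speed at least
    [r]. *)
Definition fast_hits i (r : R) k : set T :=
  [set w | hits_lim (X_from 0 w) i k /\ (r <= velocity (X_from 0 w) i)%R].

Lemma fast_hits_past i r k n : (k < n)%N -> <<s past_events X n>> (fast_hits i r k).
Proof.
move=> kn; have [ik|ki] := ltnP i k; last first.
  rewrite (_ : fast_hits i r k = set0); last first.
    by apply/seteqP; split=> w // [[]]; rewrite ltnNge ki.
  exact: (@measurable0 _ (g_sigma_algebraType (past_events X n))).
apply: (@measurableI _ (g_sigma_algebraType (past_events X n))).
  by apply: measurable_hits_lim => j jk; apply: measurable_past; exact: leq_ltn_trans kn.
apply: measurable_setP; apply: measurable_fun_ler => //.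
apply: measurableT_comp; first exact: measurable_fst.
by apply: measurable_past; exact: ltn_trans kn.
Qed.

(** If [i] is hit infinitely often, every bullet that hits it must be stopped
    from behind, and each one has the chance [escape r > 0] to escape. *)
Lemma fast_hits_null i r : (0 < r)%R -> escape r != 0 ->
  P.-negligible (lim_sup_set (fast_hits i r)).
Proof.
move=> r0 qr; set C := fast_hits i r.
have mC k : measurable (C k) by exact: past_events_measurable (fast_hits_past i r (ltnSn k)).
have mE : measurable (lim_sup_set C).
  by apply: bigcap_measurable => // m _; apply: bigcup_measurable.
have sQ : <<s @cylinders _ U>> (~` leader_survives r).
  apply: (@measurableC _ (g_sigma_algebraType (@cylinders _ U))).
  exact: measurable_leader_survives.
have [N [mN N0 goodN]] := ae_regular.
have mQ := measurable_bullets_from X 0%N (@measurable_leader_survives r).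
have qfin : escape r \is a fin_num by apply: fin_num_measure; exact: mQ.
pose c := (1 - fine (escape r))%R.
have c1 : P (X_from 0 @^-1` (~` leader_survives r)) = c%:E.
  rewrite -preimage_setC EFinB fineK// /escape.
  exact: probability_setC mQ.
have c0 : (0 <= c)%R by rewrite -lee_fin -c1.
(* decomposition according to the first hit of index at least m *)
have step m : P (lim_sup_set C) <= c%:E * P (\bigcup_(k >= m) C k).
  rewrite -bigcup_addn seqDU_bigcup_eq.
  set A := seqDU _.
  have mA k : measurable (A k) by exact: seqDU_measurable.
  have sA k : <<s past_events X (m + k).+1>> (A k).
    apply: (@measurableD _ (g_sigma_algebraType (past_events X (m + k).+1))).
      exact: fast_hits_past.
    apply: (@bigsetU_measurable _ (g_sigma_algebraType (past_events X (m + k).+1))).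
    by move=> j _; apply: fast_hits_past; rewrite ltnS leq_add2l ltnW.
  pose F k := A k `&` X_from (m + k).+1 @^-1` (~` leader_survives r).
  have mF k : measurable (F k).
    by apply: measurableI => //; exact: measurable_bullets_from.
  have tA : trivIset setT A by exact: trivIset_seqDU.
  have tF : trivIset setT F.
    apply/trivIsetP => j k _ _ jk; rewrite /F setIACA.
    by move/trivIsetP : tA => /(_ _ _ I I jk) ->; rewrite set0I.
  apply: (@le_trans _ _ (P (N `|` \bigcup_k F k))).
    apply: le_measure; rewrite ?inE//; first by apply: measurableU => //; exact: bigcupT_measurable.
    move=> w Ew; have [Nw|nNw] := pselect (N w); [by left|right].
    have gw : regular (X_from 0 w) by apply: contrapT => ng; apply: nNw; exact: goodN.
    have : (\bigcup_k A k) w.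
      by rewrite -seqDU_bigcup_eq bigcup_addn; exact: Ew.
    move=> [k _ Ak]; exists k => //; split=> // /(survives_limE 0 (regular_leader _ gw r0)) sp.
    have [/(hits_limE _ _ gw) hk rv] : C (m + k)%N w by case: Ak.
    have rk : (r <= velocity (X_from 0 w) (m + k))%R.
      have [ik [t c']] := hk; apply: (le_trans rv).
      by have [/ltW] := collide_velocity gw ik c'.
    apply: (hits_perishes gw hk (faster_leader gw r0 rk sp)).
    apply: (hits_io_survives gw) => M0; have [k' Mk' [/(hits_limE _ _ gw) ? _]] := Ew M0 I.
    by exists k'.
  apply: (@le_trans _ _ (P N + P (\bigcup_k F k))).
    by apply: measureU2 => //; exact: bigcupT_measurable.
  rewrite (N0 : P N = 0) add0e !measure_semi_bigcup//; [|exact: bigcupT_measurable..].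
  rewrite -nneseriesZl//; apply: lee_nneseries => //= k _.
  by rewrite (independent_future X_iid (sA k) sQ) c1 muleC.
have h : P (\bigcup_(k >= n) C k) @[n --> \oo] --> P (lim_sup_set C).
  apply: lim_sup_set_cvg => //; rewrite (le_lt_trans _ (ltry 1))//.
  by apply: probability_le1; exact: bigcup_measurable.
have : P (lim_sup_set C) <= c%:E * P (lim_sup_set C).
  have hc := cvgeZl (isT : c%:E \is a fin_num) h.
  move/cvg_lim: (hc) => <-//.
  by apply: lime_ge; [apply/cvg_ex; eexists; exact: hc|exact: nearW].
have : P (lim_sup_set C) \is a fin_num by exact: fin_num_measure.
have : 0 <= P (lim_sup_set C) by [].
have q0 : 0 <= escape r by [].
move=> p0 pfin pc.
suff PE : P (lim_sup_set C) = 0 by exact/negligibleP.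
move: p0 pfin pc qr q0; rewrite /c -(fineK qfin).
move: (fine (escape r)) => x; case: (P _) => // p.
rewrite -EFinM !lee_fin eqe => p0 _ pc x0 q0; congr (_%:E).
have {}q0 : (0 < x)%R by rewrite lt_neqAle eq_sym x0.
apply/eqP; rewrite eq_le p0 andbT leNgt; apply/negP => pp.
by move: pc; apply/negP; rewrite -ltNge; rewrite mulrBl mul1r ltrBlDr ltrDl mulr_gt0.
Qed.

(** For each speed there is a threshold [r] above it with [escape r = 0], in
    which case [i] almost surely perishes, being no faster than such a leader,
    or one below it with [escape r <> 0], in which case [fast_hits_null]
    applies. *)
Lemma ae_hits_finite : {ae P, forall w, forall i, exists N, forall k,
    hits (X_from 0 w) i k -> (k < N)%N}.
Proof.
have [thr thrP] := threshold_sequence (fun r => escape r = 0).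
have dies : {ae P, forall w, forall n i, escape (thr n) = 0 ->
    ~ leader_survives (thr n) (X_from i w)}.
  apply: ae_foralln => n; apply: ae_foralln => i.
  have [q0|qn0] := pselect (escape (thr n) = 0); last by apply: aeW => w /qn0.
  exists (X_from i @^-1` leader_survives (thr n)); split.
  - exact: measurable_bullets_from (@measurable_leader_survives (thr n)).
  - exact: etrans (prob_leader i (thr n)) q0.
  - by move=> w /= /not_implyP[_ /contrapT].
have fin : {ae P, forall w, forall n i, (0 < thr n)%R -> escape (thr n) <> 0 ->
    ~ lim_sup_set (fast_hits i (thr n)) w}.
  apply: ae_foralln => n; apply: ae_foralln => i.
  have [t0|nt0] := pselect (0 < thr n)%R; last by apply: aeW => w /nt0.
  have [q0|/eqP qn0] := eqVneq (escape (thr n)) 0; first by apply: aeW.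
  apply: negligibleS (fast_hits_null i t0 _).
    by move=> w /= /not_implyP[_ /not_implyP[_ /contrapT]].
  exact/eqP.
have gd := ae_regular.
move: gd dies fin; apply: filterS3 => w gw dies fin i.
apply: contrapT => /forallNP no.
have io M : exists2 k, (M <= k)%N & hits (X_from 0 w) i k.
  have /existsNP[k /not_implyP[hk kM]] := no M.
  by exists k => //; rewrite leqNgt; apply/negP.
have v0 : (0 < velocity (X_from 0 w) i)%R by case: gw.
have [n [t0 [[vt q0]|[tv qn0]]]] := thrP _ v0.
  apply: (dies n i.+1 q0).
  apply/(survives_limE _ (regular_leader i gw t0)).
  apply: slower_leader => //; exact: hits_io_survives.
apply: (fin n i t0 qn0) => M _; have [k Mk hk] := io M.
by exists k => //; split=> //; apply/hits_limE.
Qed.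

End AlmostSure.

Theorem theorem8 (R : realType) (mu nu : probability (measurableTypeR R) R)
    (mu_pos : mu `]0, +oo[%classic = 1%E) (nu_pos : nu `]0, +oo[%classic = 1%E)
    (mu_nu_valid : valid_pair mu nu)
    (d : measure_display) (T : measurableType d) (P : probability T R)
    (X : nat -> {RV P >-> (measurableTypeR R * measurableTypeR R)%type})
    (X_iid : iid_bullets X mu nu) :
  let S (w : T) : set nat := survivors (fun i => X i w) 0 [set: nat] in
  let Sn (n : nat) (w : T) : set nat :=
    survivors (fun i => X i w) 0 [set i | (i <= n)%N] in
  {ae P, forall w : T,
    (forall i : nat,
       (fun n : nat => \1_(Sn n w) i : R) @ \oo --> (\1_(S w) i : R)) /\
    counting (R := R) (S w) = limn_einf (fun n : nat => counting (R := R) (Sn n w))}.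
Proof.
move=> S Sn.
move: (ae_regular mu_pos nu_pos X_iid) (ae_hits_finite mu_pos nu_pos X_iid).
apply: filterS2 => w gw hw.
have stab := survivors_stabilize gw hw.
split=> [i|].
  have [N SnS] := stab i; apply: cvg_near_cst; exists N => // n /= Nn.
  by rewrite !indicE; congr (_%:R); congr (nat_of_bool _); apply/idP/idP;
    rewrite !inE => /(SnS n Nn).
apply: counting_liminf => [i Si|N]; last exact: survivors_cut.
by have [N SnS] := stab i; exists N => n Nn; apply/(SnS n Nn).
Qed.
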